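(* Let $s_0,m,\ell,\ell'\ge0$ be real numbers, let $s_1\geq s_0+\max\{2m+\ell',m+\ell\}$, and let $S\ge s_1$, $\delta\in[s_0,S]$ and $r>0$. Let $(V_s,\Vert\cdot\Vert_s)_{0\le s\le S}$ and $(W_s,\Vert\cdot\Vert'_s)_{0\le s\le S}$ be tame Banach scales with projections $\Pi(\Lambda)$, $\Pi'(\Lambda)$ and ranges $E(\Lambda)$, $E'(\Lambda)$ respectively ($\Lambda\in[1,\infty)$). Let $F:B_{s_0+m}\to W_{s_0}$ be $S$-tame differentiable with $F(0)=0$, and assume that $DF$ is tame right-invertible, with associated parameters $s_0,m,\ell,\ell'$ and right-inverses $L(u)$. Assume that for each $\Lambda,\Lambda'\in[1,\infty)$ the map $$u\in B_{s_0+\max\{m,\ell\}}\cap E(\Lambda)\ \mapsto\ \Pi'(\Lambda')\,DF(u)\!\upharpoonright_{E(\Lambda)}\ \in\ \mathcal{L}(E(\Lambda),E'(\Lambda'))$$ is continuous for the norms $\Vert\cdot\Vert_{s_0}$ (on $E(\Lambda)$) and $\Vert\cdot\Vert'_{s_0}$ (on $E'(\Lambda')$). Suppose moreover that the following two conditions hold. (1) For each $u\in B_{s_0+\max\{m,\ell\}}$, $$L(u)DF(u)h=h\quad\text{for all }h\in V_{s_0+m+\ell'}\text{ such that }DF(u)h\in W_{s_0+\ell'} .$$ (2) For each $s\in[s_0,S-m]$ and each $c>0$ there exists a non-decreasing function $\varepsilon_{s,c}:(0,\infty)\to(0,\infty)$ such that $\lim_{t\to0}\varepsilon_{s,c}(t)=0$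 and, for all $u_1,u_2$ in $B_{s_0+m}\cap V_{s+m}$ with $\Vert u_1\Vert_{s+m}\le c$, $$\Vert F(u_2)-F(u_1)-DF(u_1)(u_2-u_1)\Vert'_s\leq\varepsilon_{s,c}(\Vert u_2-u_1\Vert_{s+m})\,\Vert u_2-u_1\Vert_{s_0+m} .$$ Then there is at most one map $G:B'_\delta(0,r)\to B_{s_0+\max\{m,\ell\}}\cap V_{s_1}$, continuous for the norms $\Vert\cdot\Vert'_\delta$ and $\Vert\cdot\Vert_{s_1}$, such that $$G(0)=0\quad\text{and}\quad F\circ G=I_{B'_\delta(0,r)} .$$
   Context: Banach scale: a family of Banach spaces $(V_s,\Vert\cdot\Vert_s)_{0\le s\le S}$ such that $0\le s_1\le s_2\le S$ implies $V_{s_2}\subset V_{s_1}$ and $\Vert\cdot\Vert_{s_1}\le\Vert\cdot\Vert_{s_2}$ on $V_{s_2}$. Tame Banach scale: a Banach scale endowed with a family of continuous linear projections $\Pi(\Lambda)$ on $V_0$, $\Lambda\in[1,\infty)$, with range $E(\Lambda)\subset V_S$, such that $\Pi(\Lambda)\Pi(\Lambda')=\Pi(\Lambda')\Pi(\Lambda)=\Pi(\Lambda)$ for $1\le\Lambda\le\Lambda'$, and such that there are constants $A_1,A_2\ge1$ with, for all $0\le s\le S$, all $\Lambda\in[1,\infty)$ and all $u\in V_s$: $$\forall t\in[0,S],\ \Vert\Pi(\Lambda)u\Vert_t\le A_1\Lambda^{(t-s)^+}\Vert u\Vert_s;\qquad \forall t\in[0,s],\ \Vert(1-\Pi(\Lambda))u\Vert_t\le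 A_2\Lambda^{-(s-t)}\Vert u\Vert_s .$$ For the second tame scale $(W_s,\Vert\cdot\Vert'_s)$ the projections on $W_0$ are $\Pi'(\Lambda)$, with ranges $E'(\Lambda)\subset W_S$ and constants $A_1',A_2'$. Balls: $B_s=\{u\in V_s:\Vert u\Vert_s<1\}$ and $B'_s(0,r)=\{v\in W_s:\Vert v\Vert'_s<r\}$. $S$-tame differentiability: $F:B_{s_0+m}\to W_{s_0}$ is $S$-tame differentiable if it satisfies the following two requirements. First, $F$ is Gâteaux-differentiable (G-differentiable), meaning that for every $u\in B_{s_0+m}$ there is a linear map $DF(u):V_{s_0+m}\to W_{s_0}$ such that for every $s\in[s_0,S-m]$, if $u\in B_{s_0+m}\cap V_{s+m}$, then $DF(u)$ maps $V_{s+m}$ continuously into $W_s$ and $$\forall h\in V_{s+m},\quad \lim_{t\to0}\left\Vert\frac1t\left[F(u+th)-F(u)\right]-DF(u)h\right\Vert'_s=0 .$$ Second, for some constant $a>0$ and all $s\in[s_0,S-m]$, if $u\in B_{s_0+m}\cap V_{s+m}$ and $h\in V_{s+m}$, then $DF(u)h\in W_s$ with $$\Vert DF(u)h\Vert'_s\le a\left(\Vert h\Vert_{s+m}+\Vert u\Vert_{s+m}\Vert h\Vert_{s_0+m}\right).$$ Tame right-invertibility (with parameters $\ell,\ell'\ge0$): there is $b>0$ such that for all $u\in B_{s_0+\max\{m,\ell\}}$ there is a linear map $L(u):W_{s_0+\ell'}\to V_{s_0}$ satisfying $$DF(u)L(u)k=k\quad\text{for all }k\in W_{s_0+\ell'}\text{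 such that }L(u)k\in V_{s_0+m},$$ and such that for all $s_0\le s\le S-\max\{\ell,\ell'\}$, if $u\in B_{s_0+\max\{m,\ell\}}\cap V_{s+\ell}$ and $k\in W_{s+\ell'}$, then $L(u)k\in V_s$ with $$\Vert L(u)k\Vert_s\le b\left(\Vert k\Vert'_{s+\ell'}+\Vert k\Vert'_{s_0+\ell'}\Vert u\Vert_{s+\ell}\right).$$ $\mathcal{L}(E(\Lambda),E'(\Lambda'))$ is the space of bounded linear operators from $(E(\Lambda),\Vert\cdot\Vert_{s_0})$ to $(E'(\Lambda'),\Vert\cdot\Vert'_{s_0})$ with the operator norm. In condition (2), the right-hand side is read as $0$ when $u_1=u_2$. *)

(* Defs.v *)
From HB Require Import structures.
From mathcomp Require Import all_boot all_order all_algebra.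
From mathcomp Require Import all_classical all_reals all_analysis.
Set Implicit Arguments.
Unset Strict Implicit.
Unset Printing Implicit Defensive.
Import Order.TTheory GRing.Theory Num.Theory.
Import numFieldNormedType.Exports.
Local Open Scope classical_set_scope.
Local Open Scope ring_scope.

(* Maps defined on a subset D of a space X are represented by total functions
   on X whose values outside D are irrelevant; likewise a norm on a linear
   subspace A of X is a total function X -> R that is only used on A. *)

Definition linear_on (R : realType) (X Y : lmodType R) (D : set X)
    (f : X -> Y) : Prop :=
  forall (a : R) (x y : X), D x -> D y -> f (a *: x + y) = a *: f x + f y.

Definition continuous_on (R : realType) (X Y : lmodType R) (D : set X)
    (N : X -> R) (N' : Y -> R) (f : X -> Y) : Prop :=
  forall x, D x -> forall e : R, 0 < e -> exists2 d : R, 0 < d &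
    forall y, D y -> N (y - x) < d -> N' (f y - f x) < e.

(* The subset A of X, with the norm N, is a Banach space: (A, N) is the
   isometric linear copy inside X of a complete normed module. *)
Definition banach_subspace (R : realType) (X : lmodType R) (A : set X)
    (N : X -> R) : Prop :=
  exists (B : completeNormedModType R) (j : {linear B -> X}),
    [/\ injective j, range j = A & forall x, N (j x) = `|x|].

(* As V_s is contained in V_0 for every s, the carrier of a scale is V_0. *)
Record banachScale (R : realType) (S : R) := BanachScale {
  scale_carrier :> completeNormedModType R;
  sspace : R -> set scale_carrier;
  snorm : R -> scale_carrier -> R;
  sspace0 : sspace 0 = setT;
  snorm0 : forall u, snorm 0 u = `|u|;
  sspace_banach : forall s : R, 0 <= s <= S ->
    banach_subspace (sspace s) (snorm s);
  sspace_sub : forall s1 s2 : R, 0 <= s1 -> s1 <= s2 -> s2 <= S ->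
    sspace s2 `<=` sspace s1;
  snorm_le : forall s1 s2 : R, 0 <= s1 -> s1 <= s2 -> s2 <= S ->
    forall u, sspace s2 u -> snorm s1 u <= snorm s2 u
}.

Arguments sspace {R S} b _.
Arguments snorm {R S b} _ _.

(* The values of tproj at parameters smaller than 1 are irrelevant. *)
Record tameScale (R : realType) (S : R) := TameScale {
  tame_scale :> banachScale S;
  tproj : R -> {linear tame_scale -> tame_scale};
  tproj_continuous : forall La : R, 1 <= La -> continuous (tproj La);
  tproj_range : forall La : R, 1 <= La ->
    range (tproj La) `<=` sspace tame_scale S;
  tproj_comp : forall La La' : R, 1 <= La -> La <= La' -> forall u,
    tproj La (tproj La' u) = tproj La u /\ tproj La' (tproj La u) = tproj La u;
  tproj_tame : exists A1 A2 : R, [/\ 1 <= A1, 1 <= A2 &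
    forall (s La : R) u, 0 <= s <= S -> 1 <= La -> sspace tame_scale s u ->
      (forall t : R, 0 <= t <= S ->
         snorm t (tproj La u) <= A1 * La `^ (Num.max (t - s) 0) * snorm s u) /\
      (forall t : R, 0 <= t <= s ->
         snorm t (u - tproj La u) <= A2 * La `^ (- (s - t)) * snorm s u)]
}.

Arguments tproj {R S} t _.

Definition tproj_space (R : realType) (S : R) (V : tameScale S) (La : R) :
  set V := range (tproj V La).

Definition sball (R : realType) (S : R) (V : banachScale S) (s r : R) : set V :=
  [set u | sspace V s u /\ snorm s u < r].

Arguments tproj_space {R S} V La _.
Arguments sball {R S} V s r _.

(* A norm inequality or a limit for the norm of W_s includes the assertion that
   the vectors involved belong to W_s; it is spelled out, since snorm s carries
   no information outside of W_s. *)

Definition gateaux_differentiable (R : realType) (S : R) (V W : banachScale S)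
    (s0 m : R) (F : V -> W) (DF : V -> V -> W) : Prop :=
  forall u, sball V (s0 + m) 1 u ->
    [/\ linear_on (sspace V (s0 + m)) (DF u),
        (forall h, sspace V (s0 + m) h -> sspace W s0 (DF u h)) &
        forall s : R, s0 <= s <= S - m -> sspace V (s + m) u ->
          [/\ (forall h, sspace V (s + m) h -> sspace W s (DF u h)),
              continuous_on (sspace V (s + m)) (snorm (s + m)) (snorm s)
                (DF u) &
              forall h, sspace V (s + m) h ->
                (\forall t \near (0 : R)^',
                   sspace W s (t^-1 *: (F (u + t *: h) - F u) - DF u h)) /\
                (snorm s (t^-1 *: (F (u + t *: h) - F u) - DF u h)
                   @[t --> (0 : R)^'] --> (0 : R))]].

Definition tame_differentiable (R : realType) (S : R) (V W : banachScale S)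
    (s0 m : R) (F : V -> W) (DF : V -> V -> W) : Prop :=
  [/\ (forall u, sball V (s0 + m) 1 u -> sspace W s0 (F u)),
      gateaux_differentiable s0 m F DF &
      exists2 a : R, 0 < a &
        forall (s : R) u h, s0 <= s <= S - m ->
          sball V (s0 + m) 1 u -> sspace V (s + m) u -> sspace V (s + m) h ->
          sspace W s (DF u h) /\
          snorm s (DF u h) <=
            a * (snorm (s + m) h + snorm (s + m) u * snorm (s0 + m) h)].

Definition tame_right_inverse (R : realType) (S : R) (V W : banachScale S)
    (s0 m l l' : R) (DF : V -> V -> W) (L : V -> W -> V) : Prop :=
  exists2 b : R, 0 < b &
    forall u, sball V (s0 + Num.max m l) 1 u ->
      [/\ linear_on (sspace W (s0 + l')) (L u),
          (forall k, sspace W (s0 + l') k -> sspace V s0 (L u k)),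
          (forall k, sspace W (s0 + l') k -> sspace V (s0 + m) (L u k) ->
             DF u (L u k) = k) &
          forall (s : R) k, s0 <= s <= S - Num.max l l' ->
            sspace V (s + l) u -> sspace W (s + l') k ->
            sspace V s (L u k) /\
            snorm s (L u k) <=
              b * (snorm (s + l') k + snorm (s0 + l') k * snorm (s + l) u)].

(* The operator norm of f on (E, N), with values in (Y, N'); it is +oo when f is
   unbounded. *)
Definition opnorm (R : realType) (X Y : lmodType R) (E : set X)
    (N : X -> R) (N' : Y -> R) (f : X -> Y) : \bar R :=
  ereal_sup [set (N' (f h))%:E | h in [set h | E h /\ N h <= 1]].

Definition bounded_operators (R : realType) (X Y : lmodType R) (E : set X)
    (N : X -> R) (E' : set Y) (N' : Y -> R) : set (X -> Y) :=
  [set f | [/\ linear_on E f, (forall h, E h -> E' (f h)) &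
               (opnorm E N N' f < +oo)%E]].

(* T is a well-defined map from D, with the norm N, to the bounded operators
   from (E, N) to (E', N'), and it is continuous for the operator norm. *)
Definition operator_continuous_on (R : realType) (X Y : lmodType R)
    (D E : set X) (N : X -> R) (E' : set Y) (N' : Y -> R)
    (T : X -> X -> Y) : Prop :=
  (forall u, D u -> bounded_operators E N E' N' (T u)) /\
  forall u, D u -> forall e : R, 0 < e -> exists2 d : R, 0 < d &
    forall v, D v -> N (v - u) < d ->
      (opnorm E N N' (fun h => (T v h - T u h)%R) < e%:E)%E.

(* When u1 = u2 the right-hand side is 0, whatever the value of eps at 0. *)
Definition first_order_remainder (R : realType) (S : R) (V W : banachScale S)
    (s0 m : R) (F : V -> W) (DF : V -> V -> W) : Prop :=
  forall s c : R, s0 <= s <= S - m -> 0 < c ->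
    exists eps : R -> R,
      [/\ (forall t : R, 0 < t -> 0 < eps t),
          (forall t t' : R, 0 < t -> t <= t' -> eps t <= eps t'),
          eps t @[t --> (0 : R)^'+] --> (0 : R) &
          forall u1 u2,
            sball V (s0 + m) 1 u1 -> sspace V (s + m) u1 ->
            sball V (s0 + m) 1 u2 -> sspace V (s + m) u2 ->
            snorm (s + m) u1 <= c ->
            sspace W s (F u2 - F u1 - DF u1 (u2 - u1)) /\
            snorm s (F u2 - F u1 - DF u1 (u2 - u1)) <=
              eps (snorm (s + m) (u2 - u1)) * snorm (s0 + m) (u2 - u1)].

Definition continuous_local_section (R : realType) (S : R)
    (V W : banachScale S) (s0 m l s1 delta r : R) (F : V -> W) (G : W -> V) :
    Prop :=
  [/\ (forall v, sball W delta r v ->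
         sball V (s0 + Num.max m l) 1 (G v) /\ sspace V s1 (G v)),
      continuous_on (sball W delta r) (snorm delta) (snorm s1) G,
      G 0 = 0 &
      forall v, sball W delta r v -> F (G v) = v].

(* Main.v *)
Require Import Defs.
From HB Require Import structures.
From mathcomp Require Import all_boot all_order all_algebra.
From mathcomp Require Import all_classical all_reals all_analysis.
From mathcomp Require Import lra.
Set Implicit Arguments.
Unset Strict Implicit.
Import Order.TTheory GRing.Theory Num.Theory.
Import numFieldNormedType.Exports.
Local Open Scope classical_set_scope.
Local Open Scope ring_scope.

(** Two continuous local sections G1, G2 of F that agree at 0 are compared along
    the segments t |-> t v, 0 <= t <= 1, of the ball.  The set of those t where
    G1 (t v) = G2 (t v) is closed by continuity; it is open because F is locally
    injective on V_(s1) ([locally_injective]); as [0, 1] is connected and t = 0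
    belongs to the set, so does t = 1 ([connected_locally_constant]).

    Local injectivity is where the left inverse and the remainder estimate meet.
    If F u1 = F u2 and h = u2 - u1, then k = - DF(u1) h is the first order
    remainder of F at u1, so its norms of indices s0 + l' and s0 + m + l' are at
    most eps * |h|_(s0 + m), where eps is small with |h|_(s1).  As L(u1) is a left
    inverse of DF(u1), h = - L(u1) k, and the tame estimate for L(u1) at index
    s0 + m gives |h|_(s0 + m) <= b (1 + |u1|_(s1)) * eps * |h|_(s0 + m).  When
    b (1 + |u1|_(s1)) * eps < 1 this forces h = 0.  The loss of m + l' derivatives
    in k, of m more in its estimate, and of l in u1 are exactly what
    s1 >= s0 + max (2 m + l', m + l) pays for. *)

(** * Connectedness *)

(** The set where P holds and the set where it fails are both relatively open,
    so P cannot change value on a connected set. *)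
Lemma connected_locally_constant (T : topologicalType) (A : set T)
    (P : T -> Prop) :
  connected A ->
  (forall t, A t -> \forall s \near t, A s -> (P s <-> P t)) ->
  forall x y, A x -> A y -> P x -> P y.
Proof.
move=> cA Ploc x y Ax Ay Px.
suff /seteqP[_ /(_ y Ay)[]] : A `&` [set t | P t] = A by [].
apply: cA; first by exists x.
- exists (interior [set s | A s -> P s]); first exact: open_interior.
  apply/seteqP; split=> t [At Pt]; split=> //.
    by apply: filterS (Ploc t At) => s /= + As => /(_ As)[_]; apply.
  exact: (interior_subset Pt At).
- exists (~` (interior [set s | A s -> ~ P s])).
    by apply: open_closedC; exact: open_interior.
  apply/seteqP; split=> t [At Pt]; split=> //.
    by move=> /interior_subset /(_ At); apply.
  apply: contrapT => nPt; apply: Pt.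
  by apply: filterS (Ploc t At) => s /= Pst As /(Pst As).1.
Qed.

(** * The spaces of a Banach scale *)

Section BanachScale.
Context (R : realType) (S : R) (V : banachScale S) (s : R)
  (hs : 0 <= s <= S).

Lemma sspace_lin (a : R) (u w : V) :
  sspace V s u -> sspace V s w -> sspace V s (a *: u + w).
Proof.
have [B [j [_ <- _]]] := sspace_banach V hs.
by move=> [x _ <-] [y _ <-]; exists (a *: x + y) => //; rewrite linearP.
Qed.

Lemma sspace_at0 : sspace V s 0.
Proof.
have [B [j [_ <- _]]] := sspace_banach V hs.
by exists 0 => //; rewrite linear0.
Qed.

Lemma sspaceZ (a : R) (u : V) : sspace V s u -> sspace V s (a *: u).
Proof. by move=> su; rewrite -[_ *: _]addr0; apply: sspace_lin sspace_at0. Qed.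

Lemma sspaceN (u : V) : sspace V s u -> sspace V s (- u).
Proof. by move=> su; rewrite -scaleN1r; apply: sspaceZ. Qed.

Lemma sspaceB (u w : V) : sspace V s u -> sspace V s w -> sspace V s (u - w).
Proof.
move=> su sw; rewrite -[u]scale1r.
by apply: sspace_lin => //; exact: sspaceN.
Qed.

Lemma snorm_ge0 (u : V) : sspace V s u -> 0 <= snorm s u.
Proof.
have [B [j [_ <- Nj]]] := sspace_banach V hs.
by move=> [x _ <-]; rewrite Nj.
Qed.

Lemma snormD_le (u w : V) : sspace V s u -> sspace V s w ->
  snorm s (u + w) <= snorm s u + snorm s w.
Proof.
have [B [j [_ <- Nj]]] := sspace_banach V hs.
by move=> [x _ <-] [y _ <-]; rewrite -linearD !Nj ler_normD.
Qed.

Lemma snormZ (a : R) (u : V) : sspace V s u ->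
  snorm s (a *: u) = `|a| * snorm s u.
Proof.
have [B [j [_ <- Nj]]] := sspace_banach V hs.
by move=> [x _ <-]; rewrite -linearZ !Nj normrZ.
Qed.

Lemma snormN (u : V) : sspace V s u -> snorm s (- u) = snorm s u.
Proof. by move=> su; rewrite -scaleN1r snormZ// normrN1 mul1r. Qed.

Lemma snormB_le (u w : V) : sspace V s u -> sspace V s w ->
  snorm s (u - w) <= snorm s u + snorm s w.
Proof.
by move=> su sw; rewrite -(snormN sw); apply: snormD_le => //; exact: sspaceN.
Qed.

Lemma snorm_normr (u : V) : sspace V s u -> `|u| <= snorm s u.
Proof. by move=> su; rewrite -snorm0; case/andP: hs => *; exact: snorm_le. Qed.

Lemma snorm_gt0 (u : V) : sspace V s u -> u != 0 -> 0 < snorm s u.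
Proof.
by move=> su u0; apply: lt_le_trans (snorm_normr su); rewrite normr_gt0.
Qed.

End BanachScale.

(** * Local injectivity *)

(** The size d of the neighbourhood depends on u1 only through a bound for its
    norm in V_(s1): this is what allows u1 to vary along with u2. *)
Lemma locally_injective (R : realType) (s0 m l l' s1 S : R)
    (V W : banachScale S) (F : V -> W) (DF : V -> V -> W) (L : V -> W -> V) :
  0 <= s0 -> 0 <= m -> 0 <= l -> 0 <= l' ->
  s0 + Num.max (2 * m + l') (m + l) <= s1 -> s1 <= S ->
  tame_right_inverse s0 m l l' DF L ->
  (forall u, sball V (s0 + Num.max m l) 1 u ->
    forall h, sspace V (s0 + m + l') h -> sspace W (s0 + l') (DF u h) ->
      L u (DF u h) = h) ->
  first_order_remainder s0 m F DF ->
  forall c : R, 0 < c -> exists2 d : R, 0 < d &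
    forall u1 u2,
      sball V (s0 + Num.max m l) 1 u1 -> sspace V s1 u1 ->
      sball V (s0 + Num.max m l) 1 u2 -> sspace V s1 u2 ->
      snorm s1 u1 <= c -> snorm s1 (u2 - u1) < d -> F u1 = F u2 -> u1 = u2.
Proof.
move=> s0_ge0 m_ge0 l_ge0 l'_ge0 hs1 s1S [b b_gt0 hL] hleft hrem c c_gt0.
have [hs1a hs1b] : s0 + (2 * m + l') <= s1 /\ s0 + (m + l) <= s1.
  by split; apply: le_trans hs1; rewrite lerD2l le_max lexx ?orbT.
have hml : s0 + Num.max m l <= S.
  by apply: le_trans s1S; rewrite -lerBrDl ge_max; apply/andP; split; lra.
have hmm : s0 + m <= s0 + Num.max m l by rewrite lerD2l le_max lexx.
have hll : s0 + m <= S - Num.max l l'.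
  by rewrite lerBrDr -lerBrDl ge_max; apply/andP; split; lra.
have index : s0 <= s0 + m + l' <= S - m by apply/andP; split; lra.
have [eps [eps_gt0 eps_nd eps0 epsP]] := hrem _ _ index c_gt0.
(* Below this threshold the tame estimate contracts u2 - u1 strictly. *)
pose e := (b * (1 + c))^-1.
have e_gt0 : 0 < e by rewrite invr_gt0 mulr_gt0//; lra.
have [d d_gt0 epsd] : exists2 d : R, 0 < d & eps d < e.
  near (0 : R)^'+ => d; exists d; first by near: d; exact: nbhs_right_gt.
  by near: d; exact: (cvgr_lt _ eps0 _ e_gt0).
exists d => // u1 u2 B1 V1 B2 V2 u1c u12d Fu12.
apply/eqP; apply: contrapT => /negP u12.
set h := u2 - u1 in u12d *.
have h_neq0 : h != 0 by rewrite subr_eq0 eq_sym.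
have Vsub s : 0 <= s -> s <= s1 -> sspace V s1 `<=` sspace V s.
  by move=> *; apply: sspace_sub.
have Vle s u : 0 <= s -> s <= s1 -> sspace V s1 u -> snorm s u <= snorm s1 u.
  by move=> *; apply: snorm_le.
have s1_ge0 : 0 <= s1 by lra.
have Vh : sspace V s1 h by apply: sspaceB => //; rewrite s1_ge0.
have ball u : sball V (s0 + Num.max m l) 1 u -> sball V (s0 + m) 1 u.
  move=> [su nu]; split; first by apply: sspace_sub su => //; lra.
  by apply: le_lt_trans nu; apply: snorm_le => //; lra.
have [] := epsP u1 u2 (ball _ B1) _ (ball _ B2) _ _.
- by apply: Vsub V1; lra.
- by apply: Vsub V2; lra.
- by apply: le_trans u1c; apply: Vle => //; lra.
rewrite -/h Fu12 subrr sub0r => Wk nk.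
have nh_gt0 s : 0 <= s -> s <= s1 -> 0 < snorm s h.
  by move=> *; apply: snorm_gt0 => //; [apply/andP; split; lra | exact: Vsub].
have {}nk : snorm (s0 + m + l') (- DF u1 h) < e * snorm (s0 + m) h.
  apply: le_lt_trans nk _; rewrite ltr_pM2r; last by apply: nh_gt0; lra.
  apply: le_lt_trans epsd; apply: eps_nd; first by apply: nh_gt0; lra.
  by apply: le_trans (ltW u12d); apply: Vle => //; lra.
have index' : 0 <= s0 + m + l' <= S by apply/andP; split; lra.
have WDF : sspace W (s0 + m + l') (DF u1 h).
  by rewrite -[DF u1 h]opprK; apply: sspaceN.
rewrite snormN// in nk.
have DFlow : sspace W (s0 + l') (DF u1 h).
  by apply: sspace_sub WDF; lra.
have nklow : snorm (s0 + l') (DF u1 h) <= snorm (s0 + m + l') (DF u1 h).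
  by apply: snorm_le => //; lra.
have [_ _ _ /(_ (s0 + m) (DF u1 h))[]] := hL _ B1.
- by rewrite hll andbT; lra.
- by apply: Vsub V1; lra.
- by [].
(* The vector L(u1) DF(u1) h estimated here is h itself. *)
rewrite hleft//; last by apply: Vsub Vh; lra.
move=> _; apply/negP; rewrite -ltNge.
have nu1 : 0 <= snorm (s0 + m + l) u1 <= c.
  apply/andP; split.
    by apply: snorm_ge0; [apply/andP; split; lra | apply: Vsub V1; lra].
  by apply: le_trans u1c; apply: Vle => //; lra.
have nk_ge0 : 0 <= snorm (s0 + m + l') (DF u1 h) by apply: snorm_ge0.
have : b * (1 + c) * snorm (s0 + m + l') (DF u1 h) < snorm (s0 + m) h.
  by rewrite mulrC -ltr_pdivlMr ?mulr_gt0//; [rewrite mulrC | lra].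
apply: le_lt_trans; rewrite -mulrA ler_pM2l// mulrDl mul1r lerD2l mulrC.
by case/andP: nu1 => ? ?; apply: ler_pM => //; apply: snorm_ge0 DFlow; lra.
Unshelve. all: by end_near. Qed.

(** * Sections along a segment *)

Lemma sball_segment (R : realType) (S delta r : R) (W : banachScale S)
    (v : W) (t : R) :
  0 <= delta <= S -> sball W delta r v -> 0 <= t <= 1 ->
  sball W delta r (t *: v).
Proof.
move=> hd [Wv vr] /andP[t0 t1]; split; first exact: sspaceZ.
rewrite snormZ// ger0_norm//; apply: le_lt_trans vr.
by rewrite ler_piMl// snorm_ge0.
Qed.

Lemma section_near_segment (R : realType) (S s1 delta r : R)
    (V W : banachScale S) (G : W -> V) (v : W) :
  0 <= delta <= S -> sball W delta r v ->
  continuous_on (sball W delta r) (snorm delta) (snorm s1) G ->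
  forall t : R, 0 <= t <= 1 -> forall e : R, 0 < e ->
  \forall s \near t, 0 <= s <= 1 -> snorm s1 (G (s *: v) - G (t *: v)) < e.
Proof.
move=> hd Bv cG t t01 e /(cG _ (sball_segment hd Bv t01))[d d_gt0 dP].
have Wv := Bv.1; have nv := snorm_ge0 hd Wv.
have nv1 : 0 < snorm delta v + 1 by lra.
near=> s => s01; apply: dP; first exact: sball_segment.
rewrite -scalerBl snormZ//.
apply: (@le_lt_trans _ _ (`|s - t| * (snorm delta v + 1))).
  by rewrite ler_wpM2l//; lra.
rewrite -ltr_pdivlMr// distrC; near: s.
by apply: cvgr_dist_lt; [exact: cvg_id | exact: divr_gt0].
Unshelve. all: by end_near. Qed.

Theorem theorem9 (R : realType) (s0 m l l' s1 S delta r : R)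
  (hs0 : 0 <= s0) (hm : 0 <= m) (hl : 0 <= l) (hl' : 0 <= l')
  (hs1 : s0 + Num.max (2 * m + l') (m + l) <= s1) (hS : s1 <= S)
  (hdelta : s0 <= delta <= S) (hr : 0 < r)
  (V W : tameScale S)
  (F : V -> W) (DF : V -> V -> W) (L : V -> W -> V)
  (hF : tame_differentiable s0 m F DF) (hF0 : F 0 = 0)
  (hL : tame_right_inverse s0 m l l' DF L)
  (hcont : forall La La' : R, 1 <= La -> 1 <= La' ->
    operator_continuous_on
      (sball V (s0 + Num.max m l) 1 `&` tproj_space V La)
      (tproj_space V La) (snorm s0) (tproj_space W La') (snorm s0)
      (fun u h => tproj W La' (DF u h)))
  (hleft : forall u, sball V (s0 + Num.max m l) 1 u ->
    forall h, sspace V (s0 + m + l') h -> sspace W (s0 + l') (DF u h) ->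
      L u (DF u h) = h)
  (hrem : first_order_remainder s0 m F DF) :
  forall G1 G2 : W -> V,
    continuous_local_section s0 m l s1 delta r F G1 ->
    continuous_local_section s0 m l s1 delta r F G2 ->
    forall v, sball W delta r v -> G1 v = G2 v.
Proof.
move=> G1 G2 [G1V cG1 G10 FG1] [G2V cG2 G20 FG2] v Bv.
have hd : 0 <= delta <= S by case/andP: hdelta => *; apply/andP; split; lra.
have hs1S : 0 <= s1 <= S.
  apply/andP; split=> //; apply: le_trans hs1.
  by rewrite addr_ge0// le_max; apply/orP; right; lra.
rewrite -[v]scale1r.
pose I := [set t : R | 0 <= t <= 1].
have Iconn : connected I.
  have -> : I = `[0, 1]%classic by apply/seteqP; split=> t; rewrite /= in_itv.
  exact: segment_connected.
apply: (@connected_locally_constant _ I (fun t => G1 (t *: v) = G2 (t *: v))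
          Iconn _ 0 1); rewrite /I /= ?lexx ?ler01 ?scale0r ?G10 ?G20//.
move=> t t01.
have near1 := section_near_segment hd Bv cG1 t01.
have near2 := section_near_segment hd Bv cG2 t01.
have in1 s : 0 <= s <= 1 -> sspace V s1 (G1 (s *: v)).
  by move=> s01; have [] := G1V _ (sball_segment hd Bv s01).
have in2 s : 0 <= s <= 1 -> sspace V s1 (G2 (s *: v)).
  by move=> s01; have [] := G2V _ (sball_segment hd Bv s01).
have [Gt|Gt] := pselect (G1 (t *: v) = G2 (t *: v)).
- have c_gt0 : 0 < snorm s1 (G1 (t *: v)) + 1.
    by have := snorm_ge0 hs1S (in1 _ t01); lra.
  have [d d_gt0 dP] :=
    locally_injective hs0 hm hl hl' hs1 hS hL hleft hrem c_gt0.
  have d2_gt0 : 0 < d / 2 by lra.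
  near=> s => s01; split=> // _.
  have Bs := sball_segment hd Bv s01.
  have [B1 V1] := G1V _ Bs; have [B2 V2] := G2V _ Bs.
  have n1 : snorm s1 (G1 (s *: v) - G1 (t *: v)) < 1.
    by move: s01; near: s; apply: near1.
  have n1d : snorm s1 (G1 (s *: v) - G1 (t *: v)) < d / 2.
    by move: (s01); near: s; apply: near1.
  have n2d : snorm s1 (G2 (s *: v) - G2 (t *: v)) < d / 2.
    by move: (s01); near: s; apply: near2.
  apply: dP => //; last by rewrite FG1// FG2.
    rewrite -[X in snorm s1 X <= _](subrKC (G1 (t *: v))).
    apply: le_trans (snormD_le hs1S (in1 _ t01) (sspaceB hs1S V1 (in1 _ t01))) _.
    by lra.
  have -> : G2 (s *: v) - G1 (s *: v) =
      (G2 (s *: v) - G2 (t *: v)) - (G1 (s *: v) - G1 (t *: v)).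
    by rewrite Gt opprB addrA subrK.
  have := snormB_le hs1S (sspaceB hs1S V2 (in2 _ t01))
    (sspaceB hs1S V1 (in1 _ t01)); lra.
(* Half the distance between the two values keeps them apart near t. *)
- pose e := `|G1 (t *: v) - G2 (t *: v)| / 2.
  have e_gt0 : 0 < e by rewrite divr_gt0// normr_gt0 subr_eq0; apply/eqP.
  near=> s => s01; split=> // Gs; exfalso.
  have n1 : `|G1 (s *: v) - G1 (t *: v)| < e.
    apply: le_lt_trans (snorm_normr hs1S (sspaceB hs1S (in1 _ s01) (in1 _ t01))) _.
    by move: (s01); near: s; apply: near1.
  have n2 : `|G2 (s *: v) - G2 (t *: v)| < e.
    apply: le_lt_trans (snorm_normr hs1S (sspaceB hs1S (in2 _ s01) (in2 _ t01))) _.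
    by move: (s01); near: s; apply: near2.
  have := ler_distD (G1 (s *: v)) (G1 (t *: v)) (G2 (t *: v)).
  rewrite {2}Gs (distrC (G1 (t *: v)) (G1 (s *: v))); rewrite /e in n1 n2; lra.
Unshelve. all: by end_near. Qed.
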